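(* Let $G=(V,E,w)$ be a strip-type graph with vertex set $V=V_0\times\mathbb{Z}$ (that is, $G=G_0\Box\mathbb{Z}$ for a weighted graph $G_0$ with vertex set $V_0$), and let $W=W_0\times\mathbb{Z}\subseteq V$, where $W_0$ is a finite, proper, non-empty subset of $V_0$. Suppose $u\colon V\times\mathbb{R}_{\le 0}\to\mathbb{R}$ is an ancient caloric function supported on $W$; that is, it satisfies $$\begin{cases}\partial_t u(x,t)=\Delta u(x,t)+c(x)u(x,t) & \text{for }(x,t)\in W\times\mathbb{R}_{\le 0},\\ u(x,t)=0 & \text{for }(x,t)\in (V\setminus W)\times\mathbb{R}_{\le 0},\end{cases}$$ where $c\colon V\to\mathbb{R}$ is a function. Then there exists $\varepsilon_0=\varepsilon_0(G)>0$ such that the following holds. If $|c|\le\varepsilon_0$ and $u$ is of polynomial growth, in the sense that $$|u(x,t)|\le C\left(1+|\operatorname{dist}(x_0,x)|+\sqrt{-t}\right)^d$$ for some $x_0\in V$ and positive constants $C$ and $d$, then $u$ vanishes on the whole of $V$.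
   Context: A weighted graph $G=(V,E,w)$ consists of a vertex set $V$, an edge set $E\subseteq V\times V$ and a weight function $w$ on $E$ with $w_{xy}=w(x,y)>0$ for $(x,y)\in E$; $x\sim y$ means $(x,y)\in E$. All graphs are undirected ($(x,y)\in E$ iff $(y,x)\in E$, and $w_{xy}=w_{yx}$), locally finite (each vertex has finitely many neighbours) and connected. The vertex weight is $\mu(x)=\sum_{y\sim x}w_{xy}$, and the Laplacian of $f\colon V\to\mathbb{R}$ is $\Delta f(x)=\sum_{y\sim x}\frac{w_{xy}}{\mu(x)}(f(y)-f(x))$; for functions of $(x,t)$ it acts in the $x$ variable. $\operatorname{dist}(x,y)$ is the usual combinatorial graph distance (the least number of edges in a path joining $x$ to $y$). Strip-type graph: a graph of the form $G_0\Box\mathbb{Z}$, where $G_0=(V_0,E_0,w^0)$ is a weighted graph and $\mathbb{Z}$ carries its standard graph structure ($i\sim j$ iff $|i-j|=1$, all edge weights $1$, so each vertex has vertex weight $2$). The Cartesian product $G_0\Box\mathbb{Z}$ has vertex set $V_0\times\mathbb{Z}$, with $(x_0,i)\sim(y_0,j)$ iff either $x_0=y_0$ and $|i-j|=1$, or $x_0\sim y_0$ in $G_0$ and $i=j$. Its weights are $w_{(x_0,i)(x_0,j)}=\mu^0(x_0)$ for $|i-j|=1$, and $w_{(x_0,i)(y_0,i)}=2w^0_{x_0y_0}$ for $x_0\sim y_0$, where $\mu^0$ is the vertex weight of $G_0$.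
   Formalization: The constant ε₀ is allowed to depend on W₀ as well as on G; for infinite V₀ a constant depending on G alone fails, e.g. G₀=ℤ and W₀={1,…,N} with the first Dirichlet eigenfunction as u and c=λ₁(W₀)/2→0. *)

(* Defs.v *)
From mathcomp Require Import all_boot all_order all_algebra.
From mathcomp Require Import zify.
From mathcomp Require Import all_classical all_reals all_analysis.

Set Implicit Arguments.
Unset Strict Implicit.
Unset Printing Implicit Defensive.

Import Order.TTheory GRing.Theory Num.Theory.
Import numFieldNormedType.Exports.

Local Open Scope classical_set_scope.
Local Open Scope ring_scope.

(* Only the values of [wt] on pairs of adjacent vertices are meaningful. *)
Record wgraph (R : realType) (V : choiceType) := WGraph {
  adj : rel V;
  wt : V -> V -> R }.

Section WeightedGraph.
Context (R : realType) (V : choiceType) (G : wgraph R V).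

Definition joined_by (x y : V) (n : nat) : Prop :=
  exists p : seq V, [/\ path (adj G) x p, last x p = y & size p = n].

(* Loops are not excluded: edges form an arbitrary symmetric subset of
   V x V. *)
Record weighted_graph : Prop := WeightedGraph {
  adj_sym : symmetric (adj G);
  wt_gt0 : forall x y, adj G x y -> 0 < wt G x y;
  wt_sym : forall x y, adj G x y -> wt G x y = wt G y x;
  adj_finite : forall x, finite_set [set y | adj G x y];
  adj_connected : forall x y, exists n, joined_by x y n }.

Definition vertex_weight (x : V) : R :=
  \sum_(y \in [set y | adj G x y]) wt G x y.

Definition laplacian (f : V -> R) (x : V) : R :=
  \sum_(y \in [set y | adj G x y])
    (wt G x y / vertex_weight x * (f y - f x)).

(* The value 0 is assigned to pairs of vertices that are not joined by any
   path; there are none in a connected graph. *)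
Definition gdist (x y : V) : nat :=
  if pselect (exists n, `[< joined_by x y n >]) is left joined
  then ex_minn joined else 0%N.

End WeightedGraph.

(* The Cartesian product of G0 with the standard graph on the integers, whose
   edge weights 1 and vertex weights 2 give the factors below. *)
Definition strip (R : realType) (V0 : choiceType) (G0 : wgraph R V0) :
    wgraph R (V0 * int)%type :=
  {| adj := fun x y =>
       (x.1 == y.1) && (`|x.2 - y.2| == 1) ||
       adj G0 x.1 y.1 && (x.2 == y.2);
     wt := fun x y =>
       if x.2 == y.2 then 2 * wt G0 x.1 y.1 else vertex_weight G0 x.1 |}.

(* [f] has derivative [l] at [t] as a function on ]-oo, 0]: for t < 0 this is
   the usual derivative, for t = 0 the left derivative. The values of [f] at
   positive times play no role. *)
Definition has_past_derivative (R : realType) (f : R -> R) (t l : R) : Prop :=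
  (f s - f t) / (s - t) @[s --> within [set s : R | s <= 0] t^'] --> l.

Section AncientCaloric.
Context (R : realType) (V : choiceType) (G : wgraph R V).

(* Functions on V x ]-oo, 0] are represented by functions V -> R -> R whose
   values at positive times are ignored. *)
Definition ancient_caloric (c : V -> R) (W : set V) (u : V -> R -> R) : Prop :=
  (forall x (t : R), W x -> t <= 0 ->
     has_past_derivative (u x) t (laplacian G (u ^~ t) x + c x * u x t)) /\
  (forall x (t : R), ~ W x -> t <= 0 -> u x t = 0).

Definition polynomial_growth (u : V -> R -> R) : Prop :=
  exists (x0 : V) (C d : R), [/\ 0 < C, 0 < d &
    forall x (t : R), t <= 0 ->
      `|u x t| <= C * (1 + (gdist G x0 x)%:R + Num.sqrt (- t)) `^ d].

End AncientCaloric.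

Lemma vertex_weight_gt0 (R : realType) (V : choiceType) (G : wgraph R V)
    (x y : V) : weighted_graph G -> x != y -> 0 < vertex_weight G x.
Proof.
move=> wG xy; rewrite /vertex_weight.
have [n [[|z p] /= [+ + _]]] := adj_connected wG x y.
  by move=> _ /eqP; rewrite (negbTE xy).
move=> /andP[xz _] _.
rewrite (fsbigD1 z)//=; last exact: (adj_finite wG).
rewrite ltr_pwDl ?(wt_gt0 wG)//.
by apply: fsumr_ge0 => i [/= xi _]; rewrite ltW ?(wt_gt0 wG).
Qed.

Lemma joined_by_trans (R : realType) (V : choiceType) (G : wgraph R V)
    (x y z : V) m n :
  joined_by G x y m -> joined_by G y z n -> joined_by G x z (m + n)%N.
Proof.
move=> [p [pp <- <-]] [q [pq <- <-]]; exists (p ++ q).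
by rewrite cat_path pp pq last_cat size_cat.
Qed.

(* A second vertex in G0 is needed for the vertex weights of G0, which are the
   weights of the edges in the integer direction, to be positive. *)
Lemma strip_weighted_graph (R : realType) (V0 : choiceType)
    (G0 : wgraph R V0) : weighted_graph G0 ->
  (exists x y : V0, x != y) -> weighted_graph (strip G0).
Proof.
move=> wG [a [b ab]].
have mu_gt0 x : 0 < vertex_weight G0 x.
  have [xa|xa] := eqVneq x a.
    by apply: (@vertex_weight_gt0 _ _ _ _ b); rewrite ?xa.
  exact: vertex_weight_gt0 xa.
have up (x : V0) (i : int) (n : nat) :
    joined_by (strip G0) (x, i) (x, i + n%:Z) n.
  elim: n => [|n IH]; first by exists [::]; rewrite addr0.
  rewrite -addn1; apply: joined_by_trans IH _.
  exists [:: (x, i + (n + 1)%N%:Z)]; split=> //=.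
  by rewrite eqxx/= PoszD addrA opprD addNKr normrN normr1 eqxx.
have down (x : V0) (i : int) (n : nat) :
    joined_by (strip G0) (x, i) (x, i - n%:Z) n.
  elim: n => [|n IH]; first by exists [::]; rewrite subr0.
  rewrite -addn1; apply: joined_by_trans IH _.
  exists [:: (x, i - (n + 1)%N%:Z)]; split=> //=.
  by rewrite eqxx/= PoszD opprB !opprD !addrA; rewrite (_ : _ - _ = 1) //; lia.
split.
- move=> [x i] [y j]/=.
  by rewrite (eq_sym x) (eq_sym i) distrC (adj_sym wG).
- move=> [x i] [y j]/= /orP[/andP[_ /eqP ij]|/andP[xy /eqP->]].
    by case: eqP ij => [->|_ _ //]; rewrite subrr normr0.
  by rewrite eqxx mulr_gt0 ?(wt_gt0 wG).
- move=> [x i] [y j]/= /orP[/andP[/eqP-> /eqP ij]|/andP[xy /eqP->]].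
    by rewrite (eq_sym j).
  by rewrite eqxx (wt_sym wG).
- move=> [x i].
  apply: (@sub_finite_set _ _
    ([set (x, i + 1)] `|` [set (x, i - 1)] `|`
     (fun y => (y, i)) @` [set y | adj G0 x y])).
    move=> [y j]/= /orP[/andP[/eqP<- /eqP ij]|/andP[xy /eqP<-]]; last first.
      by right; exists y.
    left; have [->|->] : j = i + 1 \/ j = i - 1 by lia.
      by left.
    by right.
  rewrite !finite_setU; split; first by split; exact: finite_set1.
  by apply: finite_image; exact: (adj_finite wG).
- move=> [x i] [y j].
  have [n [p [pp <- _]]] := adj_connected wG x y.
  have H : joined_by (strip G0) (x, i) (last x p, i) (size p).
    exists [seq (z, i) | z <- p]; split; last by rewrite size_map.
      elim: p x pp => //= z p IH x /andP[xz /IH->].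
      by rewrite xz eqxx orbT.
    by rewrite (last_map (fun z => (z, i))).
  have [ij|ij] := leP i j.
    exists (size p + `|j - i|)%N; apply: joined_by_trans H _.
    by have := up (last x p) i `|j - i|%N; rewrite (_ : i + _ = j) //; lia.
  exists (size p + `|i - j|)%N; apply: joined_by_trans H _.
  by have := down (last x p) i `|i - j|%N; rewrite (_ : i - _ = j) //; lia.
Qed.

(* Main.v *)
(* Maximum principle with an exponentially growing barrier. Since W0 is finite
   and proper, G0 has a nonnegative phi, bounded below on W0, with
   Delta phi <= - lam phi on W0; for b small, psi (x, i) = phi x * 2 cosh (b i)
   still satisfies Delta psi <= - (lam / 4) psi on W0 x Z. The barrier
   psi (x, i) e^(- k t) grows exponentially in |i| and - t, so for u of
   polynomial growth, if u is positive somewhere then the quotient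
   u e^(k t) / psi attains its maximum at some point of W0 x Z x ]-oo, 0]. At
   this point comparison in space gives Delta u <= - (lam / 4) u, while
   comparison with earlier times bounds the left derivative of u from below by a
   multiple of - k u; for k and |c| small these contradict the equation. Hence
   u <= 0, and the same applies to - u. *)

Require Import Defs.
From mathcomp Require Import all_boot all_order all_algebra.
From mathcomp Require Import zify ring lra.
From mathcomp Require Import all_classical all_reals all_analysis.

Set Implicit Arguments.
Unset Strict Implicit.
Unset Printing Implicit Defensive.

Import Order.TTheory GRing.Theory Num.Theory.
Import numFieldNormedType.Exports.

Local Open Scope classical_set_scope.
Local Open Scope ring_scope.

(** * Maxima over finite sets and basic facts on weighted graphs *)

Lemma finite_set_argmax d (O : orderType d) (T : choiceType) (A : set T)
    (f : T -> O) :
  finite_set A -> A !=set0 ->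
  exists2 a, A a & forall b, A b -> (f b <= f a)%O.
Proof.
move=> /finite_seqP[s ->{A}] [a /= /perm_to_rem/perm_mem sE].
suff: exists2 b, b \in a :: rem a s & forall x, x \in a :: rem a s ->
    (f x <= f b)%O.
  by move=> [b bs fb]; exists b => [|x /= xs]; [rewrite /= sE|rewrite fb -?sE].
move: (rem a s) => {sE}{}s; elim: s a => [|b s IH] a.
  by exists a; rewrite ?mem_head// => x; rewrite inE => /eqP->.
have [y yb fy] := IH b; have [ya|ay] := leP (f y) (f a).
  exists a; rewrite ?mem_head// => x; rewrite in_cons => /orP[/eqP->//|/fy fx].
  exact: le_trans fx ya.
exists y => [|x]; first by rewrite in_cons yb orbT.
by rewrite in_cons => /orP[/eqP->|/fy//]; exact: ltW.
Qed.

Section Graph.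
Context (R : realType) (V : choiceType) (G : wgraph R V).
Hypothesis wG : weighted_graph G.

Lemma vertex_weight_ge0 x : 0 <= vertex_weight G x.
Proof. by apply: fsumr_ge0 => y xy; rewrite ltW ?(wt_gt0 wG). Qed.

(** Where [f] touches [g] from below, each difference [f y - f x] is at most [g y - g x], and the
    coefficients are nonnegative. *)
Lemma laplacian_le (f g : V -> R) x :
  (forall y, f y <= g y) -> f x = g x -> laplacian G f x <= laplacian G g x.
Proof.
move=> fg fgx; rewrite /laplacian !fsbig_finite; try exact: (adj_finite wG).
rewrite big_seq [leRHS]big_seq; apply: ler_sum => y.
rewrite in_fset_set; last exact: (adj_finite wG).
rewrite inE => /= xy; rewrite fgx; apply: ler_wpM2l; last by rewrite lerB.
by rewrite divr_ge0 ?vertex_weight_ge0// ltW ?(wt_gt0 wG).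
Qed.

Lemma gdist_le x y n : joined_by G x y n -> (gdist G x y <= n)%N.
Proof.
move=> xy; rewrite /gdist; case: pselect => // ex.
by case: ex_minnP => m _; apply; exact/asboolP.
Qed.

Lemma joined_by_gdist x y : joined_by G x y (gdist G x y).
Proof.
rewrite /gdist; case: pselect => [ex|nex].
  by case: ex_minnP => m /asboolP.
by case: (adj_connected wG x y) => n xy; case: nex; exists n; exact/asboolP.
Qed.

Lemma gdist_adj x y z : adj G y z -> (gdist G x z <= (gdist G x y).+1)%N.
Proof.
move=> yz; apply: gdist_le; rewrite -addn1.
apply: joined_by_trans (joined_by_gdist x y) _.
by exists [:: z]; rewrite /= yz.
Qed.

End Graph.

Lemma laplacianZ (R : realType) (V : choiceType) (G : wgraph R V) k
    (f : V -> R) x :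
  laplacian G (fun y => k * f y) x = k * laplacian G f x.
Proof.
rewrite /laplacian mulr_fsumr; apply: eq_fsbigr => y _.
by rewrite -mulrBr mulrCA.
Qed.

(** * The Laplacian of a strip *)

Section Strip.
Context (R : realType) (V0 : choiceType) (G0 : wgraph R V0).
Hypothesis wG0 : weighted_graph G0.

(** The levels [i + 1], [i - 1] and [i] tell the three kinds of neighbours apart, even if [G0] has
    loops. *)
Lemma strip_adj_fsum (F : V0 * int -> R) x i :
  \sum_(y \in [set y | adj (strip G0) (x, i) y]) F y =
  F (x, i + 1) + F (x, i - 1) + \sum_(y \in [set y | adj G0 x y]) F (y, i).
Proof.
have -> : [set y | adj (strip G0) (x, i) y] =
    [set (x, i + 1)] `|` [set (x, i - 1)] `|`
     (fun y => (y, i)) @` [set y | adj G0 x y].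
  apply/seteqP; split=> [[y j]/=|[y j]/=].
    move=> /orP[/andP[/eqP<- /eqP ij]|/andP[xy /eqP<-]]; last first.
      by right; exists y.
    left; have [->|->] : j = i + 1 \/ j = i - 1 by lia.
      by left.
    by right.
  move=> [[[-> ->]|[-> ->]]|[z xz [<- <-]]]; rewrite ?eqxx ?xz ?orbT//=.
    by apply/orP; left; lia.
  by apply/orP; left; lia.
have fN : finite_set ((fun y => (y, i)) @` [set y | adj G0 x y]).
  by apply: finite_image; exact: (adj_finite wG0).
rewrite fsbigU0//; last by move=> [y j]/= [[[_ ->]|[_ ->]] [z _ []]]; lia.
rewrite fsbigU0//; last by move=> [y j]/= [[_ ->] []]; lia.
by rewrite !fsbig_set1 fsbig_image// => y z _ _ [].
Qed.

Lemma strip_vertex_weight x i :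
  vertex_weight (strip G0) (x, i) = 4 * vertex_weight G0 x.
Proof.
rewrite /vertex_weight strip_adj_fsum /= eqxx -mulr_fsumr.
do 2![case: eqP => [/=|_]; first lia].
by rewrite -[\sum_(_ \in _) _]/(vertex_weight G0 x); ring.
Qed.

(** Each vertical edge carries 1/4 of the vertex weight, and each horizontal edge half of its
    fraction in [G0]. *)
Lemma strip_laplacian (f : V0 * int -> R) x i : 0 < vertex_weight G0 x ->
  laplacian (strip G0) f (x, i) =
  (f (x, i + 1) + f (x, i - 1) - 2 * f (x, i)) / 4 +
  laplacian G0 (fun y => f (y, i)) x / 2.
Proof.
move=> mu_gt0; rewrite /laplacian strip_adj_fsum strip_vertex_weight /= eqxx.
do 2![case: eqP => [/=|_]; first lia].
move: (vertex_weight G0 x) mu_gt0 => mu mu_gt0.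
rewrite mulr_fsuml; congr +%R; first by field; rewrite gt_eqF.
by apply: eq_fsbigr => y _; field; rewrite gt_eqF.
Qed.

End Strip.

(** * A strict supersolution on the base graph *)

Section Supersolution.
Context (R : realType) (V : choiceType) (G : wgraph R V).
Hypothesis wG : weighted_graph G.

Lemma laplacianE (f : V -> R) x : 0 < vertex_weight G x ->
  laplacian G f x =
  \sum_(y \in [set y | adj G x y]) wt G x y / vertex_weight G x * f y - f x.
Proof.
move=> mu_gt0; rewrite /laplacian.
transitivity (\sum_(y \in [set y | adj G x y])
    (wt G x y / vertex_weight G x * f y +
     wt G x y * (- f x / vertex_weight G x))).
  by apply: eq_fsbigr => y _; field; rewrite gt_eqF.
rewrite fsbig_split; last exact: (adj_finite wG).
rewrite -mulr_fsuml -/(vertex_weight G x) /=; congr +%R.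
by field; rewrite gt_eqF.
Qed.

(* With D x the distance from x to the complement of W, phi x = 1 - q ^ (D x):
   one neighbour of x is closer to the complement than x, and its contribution
   prevails over all the others when q is small. *)
Lemma dirichlet_supersolution (W : set V) :
  finite_set W -> W !=set0 -> W `<` [set: V] ->
  exists (phi : V -> R) (lam : R),
    [/\ 0 < lam <= 1, forall x, 0 <= phi x, forall x, W x -> 1 / 2 <= phi x &
      forall x, W x -> laplacian G phi x <= - lam * phi x].
Proof.
move=> finW W0 [_ /nonsubset[z [_ Wz]]].
have mu_gt0 x : W x -> 0 < vertex_weight G x.
  move=> Wx; apply: (@vertex_weight_gt0 _ _ _ _ z) => //.
  by apply: contra_not_neq Wz => <-.
have exD x : exists n, `[< exists2 y, ~ W y & joined_by G x y n >].
  have [n xz] := adj_connected wG x z.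
  by exists n; apply/asboolP; exists z.
pose D x := ex_minn (exD x).
(* On [W], [nb x] is the second vertex of a shortest path from [x] out of [W]; elsewhere it is a
   dummy value. *)
have /choice[nb nbP] : forall x, exists y, W x -> adj G x y /\ (D y < D x)%N.
  move=> x; case: (pselect (W x)) => [Wx|]; last by exists x.
  have : exists2 y, ~ W y & joined_by G x y (D x).
    by rewrite /D; case: ex_minnP => m /asboolP.
  move=> [w Ww [[|y p] /= [+ pw Dx]]]; first by case: Ww; rewrite -pw.
  move=> /andP[xy yp]; exists y => _; split=> //.
  rewrite {1}/D; case: ex_minnP => m _ le_m.
  rewrite -Dx ltnS; apply: le_m; apply/asboolP; exists w => //.
  by exists p.
pose p x := wt G x (nb x) / vertex_weight G x.
have p_gt0 x : W x -> 0 < p x.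
  by move=> Wx; rewrite divr_gt0 ?mu_gt0// (wt_gt0 wG)//; have [] := nbP x Wx.
have [a Wa pa] := finite_set_argmax (fun x => - p x) finW W0.
have [e We De] := finite_set_argmax D finW W0.
(* As [a] minimizes [p] on [W], [2 * q <= p x] there, so the step to [nb x] contributes at least
   [2 * q ^+ D x]; [q <= 1 / 2] gives [phi >= 1 / 2] on [W]. *)
pose q := Num.min (p a) 1 / 2.
have q_gt0 : 0 < q by rewrite divr_gt0 // lt_min p_gt0 ?ltr01.
have q_le : q <= 1 / 2 by rewrite ler_pM2r// ge_min lexx orbT.
have qp x : W x -> 2 * q <= p x.
  move=> /pa; rewrite lerN2 mulrC divfK//.
  by apply: le_trans; rewrite ge_min lexx.
have q1 : q <= 1 by lra.
(* Since [e] is farthest from the complement, [q ^+ D e] is the least [q ^+ D x] on [W]. *)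
exists (fun x => 1 - q ^+ D x), (q ^+ D e); split.
- by rewrite exprn_gt0// exprn_ile1// ltW.
- by move=> x; rewrite subr_ge0 exprn_ile1// ltW.
- move=> x Wx; have [_ Dx] := nbP x Wx.
  have : q ^+ D x <= q ^+ 1 by apply: ler_wiXn2l => //; [exact: ltW|lia].
  by rewrite expr1; lra.
move=> x Wx; have [xy Dxy] := nbP x Wx.
have -> : laplacian G (fun x => 1 - q ^+ D x) x =
    - laplacian G (fun x => q ^+ D x) x.
  rewrite -mulN1r /laplacian mulr_fsumr; apply: eq_fsbigr => y _; ring.
rewrite laplacianE; last exact: mu_gt0.
rewrite (fsbigD1 (nb x))//=; last exact: (adj_finite wG).
rewrite -/(p x); set S := (X in _ + X - _).
have S_ge0 : 0 <= S.
  apply: fsumr_ge0 => y [/= xy' _].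
  by rewrite mulr_ge0 ?exprn_ge0 ?(ltW q_gt0)// divr_ge0 ?ltW ?mu_gt0 ?(wt_gt0 wG).
have qDx : 2 * q ^+ D x <= p x * q ^+ D (nb x).
  have : q ^+ D x <= q ^+ (D (nb x)).+1 by apply: ler_wiXn2l => //; exact: ltW.
  have : 2 * q * q ^+ D (nb x) <= p x * q ^+ D (nb x).
    by rewrite ler_wpM2r ?qp// exprn_ge0// ltW.
  by rewrite exprS; lra.
(* The bounds above make the Laplacian of [phi] at most [- q ^+ D x]; it remains to use
   [q ^+ D x >= q ^+ D e] and [phi x <= 1]. *)
have qe : q ^+ D e <= q ^+ D x by apply: ler_wiXn2l (De _ Wx) => //; exact: ltW.
have : 0 < q ^+ D e by rewrite exprn_gt0.
by nra.
Qed.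

End Supersolution.

(** * Polynomial growth against exponentials *)

(** Take [ln z <= z - 1] at [z = s / d * y] and multiply by [d]. *)
Lemma powR_le_expR (R : realType) (d s : R) : 0 < d -> 0 < s ->
  exists2 A, 0 < A & forall y, 1 <= y -> y `^ d <= A * expR (s * y).
Proof.
move=> d_gt0 s_gt0; pose h := s / d.
have h_gt0 : 0 < h by rewrite divr_gt0.
exists (expR (d * (- 1 - ln h))); first exact: expR_gt0.
move=> y y1; have y_gt0 : 0 < y by lra.
rewrite /powR gt_eqF// -expRD ler_expR.
have hy_gt0 : 0 < h * y by rewrite mulr_gt0.
have : ln (1 + (h * y - 1)) <= h * y - 1 by apply: le_ln1Dx; lra.
rewrite addrC subrK lnM ?posrE// => ln_le.
have -> : s = d * h by rewrite /h mulrC divfK// gt_eqF.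
by rewrite -mulrA -mulrDr ler_pM2l//; lra.
Qed.

Lemma strip_gdist_le (R : realType) (V0 : choiceType) (G0 : wgraph R V0) v x i :
  weighted_graph (strip G0) ->
  (gdist (strip G0) v (x, i) <= gdist (strip G0) v (x, 0%R) + `|i|)%N.
Proof.
move=> wG.
have step j k : `|j - k| = 1 ->
    (gdist (strip G0) v (x, k) <= (gdist (strip G0) v (x, j)).+1)%N.
  by move=> jk; apply: gdist_adj => //=; rewrite eqxx jk.
have H n : (gdist (strip G0) v (x, Posz n) <=
      gdist (strip G0) v (x, 0%R) + n)%N /\
    (gdist (strip G0) v (x, - Posz n) <= gdist (strip G0) v (x, 0%R) + n)%N.
  elim: n => [|n [IH1 IH2]]; first by rewrite oppr0 addn0.
  split; rewrite addnS; [apply: leq_trans (step (Posz n) _ _) _ => //; lia|].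
  by apply: leq_trans (step (- Posz n) _ _) _ => //; lia.
by have [] := H `|i|%N; have [] := ltrP i 0 => hi;
  [rewrite ltz0_abs// opprK|rewrite gez0_abs].
Qed.

(** The form of growth used by the maximum principle, at an arbitrarily small rate [s]: distances to
    level 0 are bounded over the finite [W0]. *)
Lemma polynomial_growth_strip (R : realType) (V0 : choiceType)
    (G0 : wgraph R V0) (W0 : set V0) (u : V0 * int -> R -> R) :
  weighted_graph (strip G0) -> finite_set W0 -> W0 !=set0 ->
  polynomial_growth (strip G0) u ->
  forall s, 0 < s -> exists2 A, 0 < A & forall x i t, W0 x -> t <= 0 ->
    `|u (x, i) t| <= A * expR (s * (`|i|%N%:R - t)).
Proof.
move=> wG finW W0_neq0 [v [C [d [C_gt0 d_gt0 u_le]]]] s s_gt0.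
have [A A_gt0 A_le] := powR_le_expR d_gt0 s_gt0.
have [a _ a_max] :=
  finite_set_argmax (fun x => gdist (strip G0) v (x, 0%R)) finW W0_neq0.
(* The 2 absorbs the 1 of the growth condition and the 1 in [Num.sqrt (- t) <= 1 - t]. *)
pose K : R := (gdist (strip G0) v (a, 0))%:R + 2.
have K_ge2 : 2 <= K by rewrite lerDr.
exists (C * (A * expR (s * K))); first by rewrite !mulr_gt0// expR_gt0.
move=> x i t Wx t0; apply: le_trans (u_le _ _ t0) _.
have sqrt_le : Num.sqrt (- t) <= 1 - t.
  have {1}-> : 1 - t = Num.sqrt ((1 - t) ^+ 2).
    by rewrite sqrtr_sqr ger0_norm//; lra.
  by rewrite ler_sqrt ?sqr_ge0//; nra.
have dist_le : (gdist (strip G0) v (x, i))%:R <= K - 2 + `|i|%N%:R :> R.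
  rewrite addrK -natrD ler_nat; apply: leq_trans (strip_gdist_le _ _ _ wG) _.
  by rewrite leq_add2r; exact: a_max.
move: K K_ge2 dist_le => K K_ge2 dist_le.
have i_ge0 : 0 <= `|i|%N%:R :> R by [].
have d_ge0 : 0 <= (gdist (strip G0) v (x, i))%:R :> R by [].
have sqrt_ge0 := sqrtr_ge0 (- t).
rewrite -!mulrA ler_pM2l// -expRD -mulrDr.
apply: le_trans (A_le _ _); last by lra.
by apply: ge0_ler_powR; rewrite ?nnegrE; lra.
Qed.

(** * Derivatives on the past half-line *)

Section PastDerivative.
Context (R : realType) (f : R -> R) (t l : R).
Hypothesis f_t : has_past_derivative f t l.

(** The difference quotient times [s - t] tends to 0; the point [s = t], absent from the punctured
    filter, is treated apart. *)
Lemma has_past_derivative_cvg :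
  f s @[s --> within [set s : R | s <= 0] (nbhs t)] --> f t.
Proof.
pose F := within [set s : R | s <= 0] t^'.
have FF : Filter F by exact: within_filter.
have st : s - t @[s --> F] --> t - t.
  apply: cvgB; last exact: cvg_cst.
  by apply: cvg_trans (cvg_within _) _; exact: nbhs_dnbhs.
have : (f s - f t) / (s - t) * (s - t) @[s --> F] --> l * (t - t).
  exact: cvgM f_t st.
rewrite subrr mulr0 => /cvgrPdist_le H.
apply/cvgrPdist_le => e e_gt0; have := H e e_gt0.
rewrite /F !near_withinE => {}H; near=> s => s0.
have [->|st'] := eqVneq s t; first by rewrite subrr normr0 ltW.
have : s != t -> s <= 0 -> `|0 - (f s - f t) / (s - t) * (s - t)| <= e.
  by near: s.
by move=> /(_ st' s0); rewrite divfK ?subr_eq0// sub0r opprB.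
Unshelve. all: by end_near. Qed.

(** For [s < t] the quotient is at least [- f t * (expR (k * (t - s)) - 1) / (t - s)]. The factor 2
    pays for a crude bound on [expR] near 0. *)
Lemma has_past_derivative_ge k : t <= 0 -> 0 < k -> 0 < f t ->
  (forall s, s <= t -> f s * expR (k * s) <= f t * expR (k * t)) ->
  - (2 * k) * f t <= l.
Proof.
move=> t0 k_gt0 ft_gt0 f_le.
have f_left : (f s - f t) / (s - t) @[s --> t^'-] --> l.
  apply: cvg_trans f_t => P; rewrite /= !nbhs_filterE /within /=.
  rewrite /at_left /dnbhs /within /=.
  move=> H; near=> s => st.
  have : s != t -> s <= 0 -> P ((f s - f t) / (s - t)) by near: s; exact: H.
  by apply; [rewrite lt_eqF|apply: ltW; exact: lt_le_trans t0].
apply: cvgr_to_ge f_left _.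
have k2_gt0 : 0 < (2 * k)^-1 by rewrite invr_gt0 mulr_gt0.
near=> s.
have st : s < t by near: s; exact: nbhs_left_lt.
have st' : t - (2 * k)^-1 < s.
  by near: s; apply: nbhs_left_gt; lra.
pose x := k * (t - s).
have x_gt0 : 0 < x by rewrite mulr_gt0// subr_gt0.
have x_le : x <= 1 / 2.
  have -> : 1 / 2 = k * (2 * k)^-1 :> R by field; rewrite gt_eqF.
  by rewrite ler_pM2l//; lra.
(* Since [expR (- x) >= 1 - x], [expR x] is at most [1 / (1 - x)], and [(1 + 2 * x) * (1 - x) >= 1]
   for [0 <= x <= 1 / 2]. *)
have expx : expR x <= 1 + 2 * x.
  have := expR_ge1Dx (- x); have := expRxMexpNx_1 x; have := expR_gt0 x.
  nra.
have fs : f s <= f t * expR x.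
  rewrite -(ler_pM2r (expR_gt0 (k * s))) -mulrA -expRD.
  have -> : x + k * s = k * t by rewrite /x; ring.
  exact: f_le (ltW st).
rewrite ler_ndivlMr ?subr_lt0//.
have : f t * expR x <= f t * (1 + 2 * x) by rewrite ler_pM2l.
by rewrite /x; lra.
Unshelve. all: by end_near. Qed.

End PastDerivative.

(** * The barrier and the maximum principle on the strip *)

Lemma finite_set_absz_le n : finite_set [set i : int | (`|i| <= n)%N].
Proof.
apply: (@sub_finite_set _ _
    ((Posz @` `I_n.+1) `|` ((fun m => - Posz m) @` `I_n.+1))).
  move=> i /= i_le; case: (ltrP i 0) => hi; [right|left]; exists `|i|%N => /=; lia.
by rewrite finite_setU; split; apply: finite_image; exact: finite_II.
Qed.

Section Barrier.
Context (R : realType) (V0 : choiceType) (G0 : wgraph R V0) (W0 : set V0).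
Hypothesis wG0 : weighted_graph G0.
Hypothesis finW0 : finite_set W0.
Hypothesis W0_neq0 : W0 !=set0.
Hypothesis W0_proper : W0 `<` [set: V0].

Lemma exists_neq_proper x : W0 x -> exists z, x != z.
Proof.
have [_ /nonsubset[z [_ Wz]]] := W0_proper.
by move=> Wx; exists z; apply: contra_not_neq Wz => <-.
Qed.

Lemma strip_proper_weighted_graph : weighted_graph (strip G0).
Proof.
apply: strip_weighted_graph => //; have [x Wx] := W0_neq0.
by have [z xz] := exists_neq_proper Wx; exists x, z.
Qed.

Lemma strip_supersolution : exists (psi : V0 * int -> R) (b lam : R),
  [/\ 0 < b, 0 < lam, forall x, 0 <= psi x,
    forall x i, W0 x -> 1 / 2 * expR (b * `|i|%N%:R) <= psi (x, i) &
    forall x i, W0 x -> laplacian (strip G0) psi (x, i) <= - lam * psi (x, i)].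
Proof.
have [phi [lam [/andP[lam_gt0 lam_le1] phi_ge0 phi_ge phi_super]]] :=
  dirichlet_supersolution wG0 finW0 W0_neq0 W0_proper.
(* This makes the second difference of [h] equal to [lam ^+ 2 / (1 + lam) * h <= lam * h]: it adds
   at most [lam / 4] to the rate [- lam / 2] due to [phi]. *)
pose b := ln (1 + lam).
have expb : expR b = 1 + lam by rewrite lnK// posrE; lra.
pose h (i : int) := expR (b * i%:~R) + expR (- (b * i%:~R)).
have h_gt0 i : 0 < h i by rewrite addr_gt0// expR_gt0.
exists (fun x => phi x.1 * h x.2), b, (lam / 4); split.
- by apply: ln_gt0; lra.
- by rewrite divr_gt0.
- by move=> x; rewrite mulr_ge0// ltW.
- move=> x i Wx /=; apply: ler_pM; rewrite ?expR_ge0 ?phi_ge//.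
  have : expR (b * `|i|%N%:R) = expR (b * i%:~R) \/
         expR (b * `|i|%N%:R) = expR (- (b * i%:~R)).
    rewrite -mulrN -mulrNz; have [i_lt0|i_ge0] := ltP i 0; [right|left].
      by rewrite -ltz0_abs.
    by rewrite -[in RHS](gez0_abs i_ge0).
  have := expR_gt0 (b * i%:~R); have := expR_gt0 (- (b * i%:~R)).
  by rewrite /h => ? ? [] ->; lra.
move=> x i Wx; rewrite strip_laplacian//=; last first.
  have [z xz] := exists_neq_proper Wx.
  exact: vertex_weight_gt0 xz.
have -> : laplacian G0 (fun y => phi y * h i) x = h i * laplacian G0 phi x.
  by rewrite -laplacianZ; congr laplacian; apply/funext => y; rewrite mulrC.
have hE : (h (i + 1) + h (i - 1) - 2 * h i) * (1 + lam) = lam ^+ 2 * h i.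
  have -> : h (i + 1) = expR (b * i%:~R) * expR b +
      expR (- (b * i%:~R)) * expR (- b).
    by rewrite /h -!expRD intrD; congr (expR _ + expR _); ring.
  have -> : h (i - 1) = expR (b * i%:~R) * expR (- b) +
      expR (- (b * i%:~R)) * expR b.
    by rewrite /h -!expRD intrB; congr (expR _ + expR _); ring.
  by rewrite /h [expR (- b)]expRN expb; field; lra.
have hle : h (i + 1) + h (i - 1) - 2 * h i <= lam * h i.
  rewrite -(ler_pM2r (_ : 0 < 1 + lam)); last by lra.
  rewrite hE; have := h_gt0 i; nra.
have := phi_super x Wx; have := phi_ge0 x; have := h_gt0 i.
move: (laplacian _ _ _) (phi x) (h i) hle => L p H hle H_gt0 p_ge0 Lp.
have : H * L <= H * (- lam * p) by rewrite ler_pM2l.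
have : p * (h (i + 1) + h (i - 1) - 2 * H) <= p * (lam * H).
  by rewrite ler_wpM2l.
lra.
Qed.


Lemma caloric_le0 psi b lam (c : V0 * int -> R) (u : V0 * int -> R -> R) :
  0 < b -> 0 < lam -> (forall x, 0 <= psi x) ->
  (forall x i, W0 x -> 1 / 2 * expR (b * `|i|%N%:R) <= psi (x, i)) ->
  (forall x i, W0 x -> laplacian (strip G0) psi (x, i) <= - lam * psi (x, i)) ->
  ancient_caloric (strip G0) c (W0 `*` [set: int]) u ->
  (forall x, `|c x| <= lam / 4) ->
  (forall s, 0 < s -> exists2 A, 0 < A & forall x i t, W0 x -> t <= 0 ->
    `|u (x, i) t| <= A * expR (s * (`|i|%N%:R - t))) ->
  forall x t, t <= 0 -> u x t <= 0.
Proof.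
move=> b_gt0 lam_gt0 psi_ge0 psi_ge psi_super [u_eq u_out] c_le u_growth.
have wG := strip_proper_weighted_graph.
move=> x1 t1 t1_le0; rewrite leNgt; apply/negP => u1_gt0.
have u_notin y t : ~ W0 y.1 -> t <= 0 -> u y t = 0.
  by move=> Wy t_le0; apply: u_out => // -[].
have Wx1 : W0 x1.1.
  apply: contrapT => Wx1; move: u1_gt0.
  by rewrite u_notin// ltxx.
(* Time comparison costs [2 * k = lam / 2] and [c] costs [lam / 4], together less than the [lam]
   gained in space. *)
pose k := lam / 4; have k_gt0 : 0 < k by rewrite divr_gt0.
(* Growth of [u] at rate [s] uses at most half of the barrier's rates [b] and [k], so [w] still
   decays at rate [s]. *)
pose s := Num.min b k / 2.
have s_gt0 : 0 < s by rewrite divr_gt0// lt_min b_gt0.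
have sb : 2 * s <= b by rewrite mulrC divfK// ge_min lexx.
have sk : 2 * s <= k by rewrite mulrC divfK// ge_min lexx orbT.
have [A A_gt0 A_le] := u_growth s s_gt0.
have psi_gt0 y : W0 y.1 -> 0 < psi y.
  case: y => y i Wy; apply: lt_le_trans (psi_ge _ _ Wy).
  by rewrite mulr_gt0// expR_gt0.
pose w y t := u y t * expR (k * t) / psi y.
have w_le y i t : W0 y -> t <= 0 ->
    w (y, i) t <= 2 * A * expR (- (s * (`|i|%N%:R - t))).
  move=> Wy t_le0; rewrite /w ler_pdivrMr ?psi_gt0//.
  set r := `|i|%N%:R - t.
  have r1 : s * r + k * t <= - (s * r) + b * `|i|%N%:R.
    have i_ge0 : 0 <= `|i|%N%:R :> R by [].
    rewrite /r; nra.
  apply: (@le_trans _ _ (A * expR (s * r + k * t))).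
    rewrite expRD mulrA ler_pM2r ?expR_gt0//.
    by apply: le_trans (A_le _ _ _ Wy t_le0); exact: ler_norm.
  apply: (@le_trans _ _ (A * expR (- (s * r) + b * `|i|%N%:R))).
    by rewrite ler_pM2l// ler_expR.
  have -> : A * expR (- (s * r) + b * `|i|%N%:R) =
      2 * A * expR (- (s * r)) * (1 / 2 * expR (b * `|i|%N%:R)).
    by rewrite expRD; field.
  by rewrite ler_pM2l ?psi_ge// !mulr_gt0// expR_gt0.
have w1_gt0 : 0 < w x1 t1 by rewrite divr_gt0 ?psi_gt0// mulr_gt0// expR_gt0.
(* By [expR (s * r) >= 1 + s * r], the decay of [w] confines the points with [w >= w x1 t1] to
   [r = |i| - t <= M]. *)
pose M := 2 * A / w x1 t1 / s.
have M_ge0 : 0 <= M.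
  apply: divr_ge0 (ltW s_gt0); apply: divr_ge0 (ltW w1_gt0).
  by apply: mulr_ge0 => //; exact: ltW.
pose N := Num.bound M.
have boxP y i t : W0 y -> t <= 0 -> w x1 t1 <= w (y, i) t ->
    `|i|%N%:R - t <= N%:R.
  move=> Wy t_le0 w1_le; apply: le_trans (ltW (archi_boundP M_ge0)).
  have := le_trans w1_le (w_le _ i _ Wy t_le0).
  rewrite /M expRN; set r := `|i|%N%:R - t => w1r.
  rewrite !ler_pdivlMr//.
  move: w1r; rewrite ler_pdivlMr ?expR_gt0// => w1r.
  have : w x1 t1 * (1 + s * r) <= w x1 t1 * expR (s * r).
    by rewrite ler_pM2l// expR_ge1Dx.
  by nra.
(* [T y] is a time in [[- N, 0]] maximizing [w y], with dummy value 0 outside [W0]. *)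
have /choice[T TP] y : exists t, W0 y.1 ->
    [/\ - N%:R <= t, t <= 0 &
      forall t', - N%:R <= t' -> t' <= 0 -> w y t' <= w y t].
  case: (pselect (W0 y.1)) => [Wy|]; last by exists 0.
  have N_le0 : - N%:R <= 0 :> R by rewrite oppr_le0.
  have [|t] := @EVT_max R (w y) _ _ N_le0.
    apply/subspace_continuousP => t /=; rewrite in_itv/= => /andP[_ t_le0].
    apply: cvgM; last exact: cvg_cst.
    apply: cvgM.
      have := has_past_derivative_cvg (u_eq y t (conj Wy I) t_le0).
      apply: cvg_trans; apply: cvg_app.
      apply: within_subset.
      by move=> t' /=; rewrite in_itv/= => /andP[].
    apply: cvg_within_filter; apply: continuous_comp; last exact: continuous_expR.
    by apply: cvgM; [exact: cvg_cst|exact: cvg_id].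
  rewrite in_itv/= => /andP[Nt t_le0] t_max; exists t => _; split=> // t' Nt' t'_le0.
  by apply: t_max; rewrite in_itv/= Nt'.
pose K := W0 `*` [set i : int | (`|i| <= N)%N].
have finK : finite_set K by apply: finite_setX => //; exact: finite_set_absz_le.
have inK y t : W0 y.1 -> t <= 0 -> w x1 t1 <= w y t -> K y /\ - N%:R <= t.
  case: y => y i Wy t_le0 w1_le; have := boxP y i t Wy t_le0 w1_le => box.
  have i_ge0 : 0 <= `|i|%N%:R :> R by [].
  split; last by lra.
  by split => //=; rewrite -(ler_nat R); lra.
have [Kx1 Nt1] := inK x1 t1 Wx1 t1_le0 (lexx _).
have [x0 [Wx0 _] x0_max] :=
  finite_set_argmax (fun y => w y (T y)) finK (ex_intro _ x1 Kx1).
have [_ t0_le0 _] := TP x0 Wx0.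
set t0 := T x0 in x0_max t0_le0; set m := w x0 t0 in x0_max.
have m_ge : w x1 t1 <= m.
  have [_ _ t_max] := TP x1 Wx1.
  by apply: le_trans (x0_max x1 Kx1); exact: t_max.
have m_gt0 : 0 < m by exact: lt_le_trans m_ge.
(* This is [w <= m] without denominators, so that it holds at all vertices: outside [W0], [u]
   vanishes and [psi >= 0]. *)
have u_le y t : t <= 0 -> u y t * expR (k * t) <= m * psi y.
  move=> t_le0; case: (pselect (W0 y.1)) => [Wy|Wy]; last first.
    by rewrite u_notin// mul0r mulr_ge0// ltW.
  rewrite -ler_pdivrMr ?psi_gt0// -/(w y t).
  have [w1_le|/ltW w1_ge] := leP (w x1 t1) (w y t); last exact: le_trans m_ge.
  have [Ky Nt] := inK y t Wy t_le0 w1_le; have [_ _ t_max] := TP y Wy.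
  by apply: le_trans (x0_max _ Ky); exact: t_max.
have u0E : u x0 t0 * expR (k * t0) = m * psi x0.
  by rewrite /m /w divfK// gt_eqF// psi_gt0.
pose e := expR (k * t0); have e_gt0 : 0 < e by exact: expR_gt0.
have me_gt0 : 0 < m / e by exact: divr_gt0.
have u0_gt0 : 0 < u x0 t0.
  rewrite -(pmulr_lgt0 _ e_gt0) [X in 0 < X]u0E.
  by apply: mulr_gt0 => //; exact: psi_gt0.
(* At time [t0] the function [m / e * psi] lies above [u] and touches it at [x0]. *)
have lap_le : laplacian (strip G0) (u ^~ t0) x0 <= - lam * u x0 t0.
  apply: (@le_trans _ _ (laplacian (strip G0) (fun y => m / e * psi y) x0)).
    apply: (laplacian_le wG) => [y|].
      by rewrite mulrAC ler_pdivlMr// u_le.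
    by rewrite mulrAC -u0E mulfK// gt_eqF.
  have -> : u x0 t0 = m / e * psi x0 by rewrite mulrAC -u0E mulfK// gt_eqF.
  rewrite laplacianZ mulrCA ler_pM2l//.
  by rewrite [x0]surjective_pairing psi_super.
have := c_le x0; rewrite ler_norml => /andP[_ c0_le].
have : - (2 * k) * u x0 t0 <=
    laplacian (strip G0) (u ^~ t0) x0 + c x0 * u x0 t0.
  apply: (has_past_derivative_ge (u_eq x0 t0 (conj Wx0 I) t0_le0)) => // t t_le.
  rewrite u0E; apply: u_le; exact: le_trans t0_le0.
have : c x0 * u x0 t0 <= lam / 4 * u x0 t0 by rewrite ler_pM2r.
have : 0 < lam * u x0 t0 by rewrite mulr_gt0.
by rewrite /k; lra.
Qed.

End Barrier.

(** * Vanishing of ancient caloric functions *)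

Theorem theorem1p1 (R : realType) (V0 : choiceType) (G0 : wgraph R V0)
    (W0 : set V0) :
  weighted_graph G0 ->
  finite_set W0 -> W0 !=set0 -> W0 `<` [set: V0] ->
  exists eps0 : R, 0 < eps0 /\
    forall (c : V0 * int -> R) (u : V0 * int -> R -> R),
      ancient_caloric (strip G0) c (W0 `*` [set: int]) u ->
      (forall x : V0 * int, `|c x| <= eps0) ->
      polynomial_growth (strip G0) u ->
      forall (x : V0 * int) (t : R), t <= 0 -> u x t = 0.
Proof.
move=> wG0 finW0 W0_neq0 W0_proper.
have [psi [b [lam [b_gt0 lam_gt0 psi_ge0 psi_ge psi_super]]]] :=
  strip_supersolution wG0 finW0 W0_neq0 W0_proper.
(* [lam] comes from the barrier alone, hence is fixed before [c] and [u]. *)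
exists (lam / 4); split=> [|c u u_cal c_le u_pol x t t_le0].
  by rewrite divr_gt0.
have u_le0 v : ancient_caloric (strip G0) c (W0 `*` [set: int]) v ->
    polynomial_growth (strip G0) v -> v x t <= 0.
  move=> v_cal v_pol.
  apply: (caloric_le0 wG0 finW0 W0_neq0 W0_proper b_gt0 lam_gt0 psi_ge0 psi_ge
    psi_super v_cal c_le) => //.
  have wG := strip_proper_weighted_graph wG0 W0_neq0 W0_proper.
  exact: (polynomial_growth_strip wG finW0 W0_neq0 v_pol).
apply/eqP; rewrite eq_le u_le0//= -oppr_le0.
apply: (u_le0 (fun y t => - u y t)); last first.
  have [v [C [d [C_gt0 d_gt0 u_le]]]] := u_pol.
  by exists v, C, d; split=> // y r r_le0; rewrite normrN u_le.
have [u_eq u_out] := u_cal.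
split=> [y r Wy r_le0|y r Wy r_le0]; last by rewrite u_out// oppr0.
have -> : laplacian (strip G0) (fun z => - u z r) y + c y * - u y r =
    - (laplacian (strip G0) (u ^~ r) y + c y * u y r).
  rewrite mulrN opprD -[X in _ = X + _]mulN1r -laplacianZ.
  by congr (laplacian _ _ _ + _); apply/funext => z; rewrite mulN1r.
rewrite /has_past_derivative.
under eq_fun do rewrite opprK addrC -[X in X / _]opprB mulNr.
by apply: cvgN; exact: u_eq.
Qed.
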